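(* Let $q=2^{m}$ with $m\ge 1$, and let $r,s$ be positive integers with $s\equiv r+3\pmod{q+1}$. Let $B(x)\in\mathbb{F}_{q^2}[x]$ be such that $B(x)$ has no root in $\mu_{q+1}$ and $x\mapsto x^{r}B^{(q)}(1/x)/B(x)$ permutes $\mu_{q+1}$. Let $a\in\mathbb{F}_{q^2}\setminus\mathbb{F}_q$ and $b\in\mathbb{F}_q^{*}$ with $a^{q+1}+b^{2}\neq 0$. Then $$x^{s}B(x^{q-1})\left(a^{q}+bx^{q-1}+bx^{2(q-1)}+ax^{3(q-1)}\right)$$ permutes $\mathbb{F}_{q^2}$ if and only if the following three conditions hold: (i) $\gcd(s,q-1)=1$; (ii) $\mathrm{Tr}\left(\dfrac{(a^{q}+b)^{3}(a+b)^{3}}{(a+a^{q})^{2}(a^{q+1}+b^{2})^{2}}\right)=\mathrm{Tr}(1)$; (iii) for any $\delta\in\mathbb{F}_{q^2}\setminus\mathbb{F}_q$, the roots $t_1,t_2$ of $$x^{2}+\frac{(\delta^{q}+\delta)^{3}(a^{q+1}+b^{2})}{(a+a^{q})^{2}}\,x+\frac{(\delta+\delta^{q})^{6}(a^{q}+b)^{3}(a+b)^{3}}{(a+a^{q})^{6}}$$ are not cubes in $\mathbb{F}_q$ if $m$ is even, and are not cubes in $\mathbb{F}_{q^2}$ if $m$ is odd.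
   Context: $\mu_{q+1}$ denotes the set of $(q+1)$-th roots of unity in $\mathbb{F}_{q^2}$. For $B(x)\in\mathbb{F}_{q^2}[x]$, $B^{(q)}(x)$ denotes the polynomial obtained from $B(x)$ by raising every coefficient to the $q$-th power. $\mathrm{Tr}$ is the absolute trace $\mathbb{F}_q\to\mathbb{F}_2$, $\mathrm{Tr}(x)=x+x^2+x^{2^2}+\cdots+x^{2^{m-1}}$. A polynomial permutes a finite set if it induces a bijection of that set onto itself. *)

(* Defs.v *)
From HB Require Import structures.
From mathcomp Require Import all_boot all_order all_algebra all_field.

Set Implicit Arguments.
Unset Strict Implicit.
Unset Printing Implicit Defensive.

Import GRing.Theory.
Local Open Scope ring_scope.

Definition mu (F : finFieldType) (n : nat) : {set F} :=
  [set x : F | n.-unity_root x].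

Definition permutes (F : finFieldType) (A : {set F}) (f : F -> F) : Prop :=
  f @: A = A /\ {in A &, injective f}.

(* B^(q); for B = \sum_i b_i X^i this is \sum_i b_i^q X^i. *)
Definition conj_poly (F : finFieldType) (q : nat) (B : {poly F}) : {poly F} :=
  map_poly (fun c : F => c ^+ q) B.

(* On the subfield of order 2 ^ m this is the absolute trace; its values 0 and
   1 of F_2 are taken inside F. *)
Definition abs_tr (F : finFieldType) (m : nat) (x : F) : F :=
  \sum_(i < m) x ^+ (2 ^ i).

Definition cube_in (F : finFieldType) (E : {set F}) (t : F) : Prop :=
  exists2 u : F, u \in E & t = u ^+ 3.

Definition perm_poly3 (F : finFieldType) (q s : nat) (B : {poly F}) (a b : F)
    : {poly F} :=
  'X^s * (B \Po 'X^(q - 1))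
  * ((a ^+ q)%:P + b *: 'X^(q - 1) + b *: 'X^(2 * (q - 1))
     + a *: 'X^(3 * (q - 1))).

Definition cube_quadratic (F : finFieldType) (q : nat) (a b d : F)
    : {poly F} :=
  'X^2
  + ((d ^+ q + d) ^+ 3 * (a ^+ (q + 1) + b ^+ 2) / (a + a ^+ q) ^+ 2) *: 'X
  + ((d + d ^+ q) ^+ 6 * (a ^+ q + b) ^+ 3 * (a + b) ^+ 3
     / (a + a ^+ q) ^+ 6)%:P.

(* Main.v *)
(* Let h(x) = a^q + b x + b x^2 + a x^3. Since x^3 h^(q)(1/x) = h(x) on mu_(q+1),
   the map induced on mu_(q+1) by the polynomial is x^r B^(q)(1/x) / B(x) as long
   as h has no root there. Hence the polynomial permutes F_(q^2) iff
   gcd(s, q - 1) = 1 and h has no root in mu_(q+1).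

   With d = a + b, the Moebius map y |-> (y + d^q) / (y + d) sends F_q onto
   mu_(q+1) minus 1, where 1 is not a root of h, and turns h into the depressed
   cubic y^3 + al y + be with al = d^(q+1) and be = (a + a^q)(a^(q+1) + b^2).
   By Cardano's formulas, y = u + al/u is a root iff t = u^3 is a root of
   t^2 + be t + al^3. The trace condition tells whether t lies in F_q, and
   comparing t with its conjugate tells when some u gives y in F_q (the criterion
   of Williams). Scaling t by a cube of F_q absorbs the parameter delta. *)
Require Import Defs.
From HB Require Import structures.
From mathcomp Require Import all_boot all_order all_algebra all_field.
From mathcomp Require Import cyclic ring zify.

Set Implicit Arguments.
Unset Strict Implicit.
Unset Printing Implicit Defensive.

Import GRing.Theory.
Local Open Scope ring_scope.

(** * Power maps in finite fields *)

Lemma expf_card_pred (F : finFieldType) (x : F) : x != 0 -> x ^+ #|F|.-1 = 1.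
Proof.
move=> x0; apply: (mulfI x0); rewrite mulr1 -exprS prednK ?expf_card //.
by apply: ltnW; apply: finNzRing_gt1.
Qed.

Lemma finField_primitive_root (F : finFieldType) :
  exists g : F, (#|F|.-1).-primitive_root g.
Proof.
have F_gt1 : (1 < #|F|)%N by apply: finNzRing_gt1.
suff /hasP[g _ gP] : has (#|F|.-1).-primitive_root (rem 0 (enum F)).
  by exists g.
apply: has_prim_root.
- by rewrite -ltnS prednK // ltnW.
- apply/allP => x; rewrite mem_rem_uniq ?enum_uniq // !inE => /andP[x0 _].
  by rewrite unity_rootE expf_card_pred.
- by rewrite rem_uniq ?enum_uniq.
- by rewrite size_rem ?mem_enum // -cardE leqnn.
Qed.

(** The multiplicative group is cyclic: writing [x = g ^+ i], the equation [x ^+ k = 1] makes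
    [n * k] divide [i * k], so [n] divides [i]. *)
Lemma finField_expf_surj (F : finFieldType) (n k : nat) (x : F) :
  (n * k = #|F|.-1)%N -> x ^+ k = 1 -> exists u : F, x = u ^+ n.
Proof.
move=> nk xk1; have [g gP] := finField_primitive_root F.
have nk_gt0 : (0 < n * k)%N by rewrite nk (prim_order_gt0 gP).
have k_gt0 : (0 < k)%N by case: k nk_gt0 {nk xk1} => //; rewrite muln0.
have /(prim_rootP gP)[i xi] : x ^+ #|F|.-1 = 1.
  by rewrite -nk mulnC exprM xk1 expr1n.
have : (#|F|.-1 %| i * k)%N.
  by rewrite (prim_order_dvd gP) exprM -xi xk1.
rewrite -[X in (X %| _)%N]nk dvdn_pmul2r // => /dvdnP[j ij].
by exists (g ^+ j); rewrite xi ij exprM.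
Qed.

(** * Characteristic 2: the trace and Artin-Schreier polynomials *)

Lemma addr_eq0_pchar2 (R : nzRingType) (x y : R) :
  2%N \in [pchar R] -> x + y = 0 -> x = y.
Proof. by move=> R2 /eqP; rewrite addr_eq0 oppr_pchar2 // => /eqP. Qed.

Lemma natr_pchar2 (R : nzRingType) (n : nat) :
  2%N \in [pchar R] -> n%:R = (odd n)%:R :> R.
Proof.
move=> R2; rewrite -[n in LHS]odd_double_half -muln2 natrD natrM.
by rewrite (pcharf0 R2) mulr0 addr0.
Qed.

(* [ring] only replaces coefficients that occur literally on the left-hand side
   of a given equation, hence one equation per coefficient. *)
Ltac ring2 R2 :=
  let h2 := fresh in have h2 : _ = 0 := natr_pchar2 2 R2;
  let h3 := fresh in have h3 : _ = 1 := natr_pchar2 3 R2;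
  let h4 := fresh in have h4 : _ = 0 := natr_pchar2 4 R2;
  let h5 := fresh in have h5 : _ = 1 := natr_pchar2 5 R2;
  let h6 := fresh in have h6 : _ = 0 := natr_pchar2 6 R2;
  let h7 := fresh in have h7 : _ = 1 := natr_pchar2 7 R2;
  let h8 := fresh in have h8 : _ = 0 := natr_pchar2 8 R2;
  let h9 := fresh in have h9 : _ = 1 := natr_pchar2 9 R2;
  let h10 := fresh in have h10 : _ = 0 := natr_pchar2 10 R2;
  let h16 := fresh in have h16 : _ = 0 := natr_pchar2 16 R2;
  ring: h2 h3 h4 h5 h6 h7 h8 h9 h10 h16.

Lemma exprD_pow2 (R : comNzRingType) (k : nat) (x y : R) :
  2%N \in [pchar R] -> (x + y) ^+ (2 ^ k) = x ^+ (2 ^ k) + y ^+ (2 ^ k).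
Proof.
by move=> R2; rewrite exprDn_pchar // pnatX (eq_pnat _ (pcharf_eq R2)) pnat_id.
Qed.

(** Squaring shifts the terms of the trace by one, so the sum telescopes. *)
Lemma abs_tr_artin_schreier (F : finFieldType) (m : nat) (z : F) :
  2%N \in [pchar F] -> abs_tr m (z ^+ 2 + z) = z ^+ (2 ^ m) + z.
Proof.
move=> F2; rewrite /abs_tr; elim: m => [|m IH].
  by rewrite big_ord0 expn0 expr1 addrr_pchar2.
rewrite big_ord_recr /= IH exprD_pow2 // -exprM -expnS.
by ring2 F2.
Qed.

Lemma abs_tr1 (F : finFieldType) (m : nat) :
  2%N \in [pchar F] -> abs_tr m 1 = (odd m)%:R :> F.
Proof.
move=> F2; rewrite /abs_tr (eq_bigr (fun=> 1)) => [|i _]; last by rewrite expr1n.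
by rewrite sumr_const card_ord natr_pchar2.
Qed.

(** The same telescoping for polynomials: the multiple is the sum of the powers [p ^+ (2 ^ i)],
    [i < k], of the divisor [p]. *)
Lemma dvdp_artin_schreier (F : finFieldType) (k : nat) (c : F) :
  2%N \in [pchar F] ->
  'X^2 + 'X + c%:P %| 'X^(2 ^ k) + 'X + (abs_tr k c)%:P.
Proof.
move=> F2; have P2 : 2%N \in [pchar {poly F}] by rewrite pchar_poly.
rewrite /abs_tr; elim: k => [|k IH].
  by rewrite big_ord0 expn0 expr1 addr0 addrr_pchar2 // dvdp0.
rewrite big_ord_recr /= polyCD polyC_exp.
set p := 'X^2 + 'X + _ in IH *; set v := (\sum_(i < k) _)%:P in IH *.
have -> : 'X^(2 ^ k.+1) + 'X + (v + c%:P ^+ (2 ^ k))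
    = 'X^(2 ^ k) + 'X + v + p ^+ (2 ^ k).
  rewrite !exprD_pow2 // -exprM -expnS.
  by ring2 P2.
by rewrite dvdp_add // dvdp_exp // expn_gt0.
Qed.

Lemma dvdp_finField_root (F : finFieldType) (p : {poly F}) :
  (1 < size p)%N -> p %| 'X^#|F| - 'X -> exists z, root p z.
Proof.
move=> p_gt1; rewrite finField_genPoly => /dvdp_prod_XsubC[s].
case E: (mask s _) => [|z r] pE; last first.
  by exists z; rewrite (eqp_root pE) big_cons rootM root_XsubC eqxx.
by move: p_gt1; rewrite (eqp_size pE) big_nil size_poly1.
Qed.

(** Governs cubes in F_q: for odd [m], 3 is prime to q - 1 and cubing is bijective; for even [m], 3
    divides q - 1. *)
Lemma pow2_mod3 (m : nat) : exists j, (2 ^ m = 3 * j + (odd m).+1)%N.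
Proof.
exists (2 ^ m %/ 3)%N; rewrite [LHS](divn_eq _ 3) mulnC; congr (_ + _)%N.
rewrite -[in LHS](odd_double_half m) expnD -mul2n expnM.
by rewrite -modnMmr -(modnXm _ _ (2 ^ 2)) exp1n; case: (odd m).
Qed.

Lemma dvdn_div_eq1 (n d : nat) :
  (0 < n)%N -> (d %| n)%N -> (n %| n %/ d)%N -> d = 1%N.
Proof.
move=> n_gt0 d_n n_dvd; have d_gt0 := dvdn_gt0 n_gt0 d_n.
have nd_gt0 : (0 < n %/ d)%N by rewrite divn_gt0 // dvdn_leq.
apply/eqP; rewrite eqn_leq d_gt0 andbT leqNgt; apply/negP => d_gt1.
by have := dvdn_leq nd_gt0 n_dvd; rewrite leqNgt ltn_Pdiv.
Qed.

(** * The field with q^2 elements and its Frobenius map over F_q *)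

Section QuadraticExtension.

Variables (F : finFieldType) (m q : nat).
Hypotheses (hq : q = (2 ^ m)%N) (hF : #|F| = (q ^ 2)%N).

Lemma pchar2_of_card : 2%N \in [pchar F].
Proof. by apply: (@card_finPcharP _ _ (m * 2)); rewrite // expnM -hq. Qed.

Let F2 := pchar2_of_card.

Lemma frobD (x y : F) : (x + y) ^+ q = x ^+ q + y ^+ q.
Proof. by rewrite hq exprD_pow2. Qed.

Lemma frobK (x : F) : x ^+ q ^+ q = x.
Proof. by rewrite -exprM mulnn -hF expf_card. Qed.

Lemma frob_div (x y : F) : (x / y) ^+ q = x ^+ q / y ^+ q.
Proof. by rewrite exprMn exprVn. Qed.

(** The sum of all 2m conjugates of [c] consists of two equal halves, hence vanishes; so X^2 + X + c
    divides X^(q^2) - X, which splits over [F]. *)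
Lemma artin_schreier_root (c : F) :
  c ^+ q = c -> exists z : F, z ^+ 2 + z = c.
Proof.
move=> cq; have [||z] := @dvdp_finField_root F ('X^2 + 'X + c%:P).
- rewrite -addrA size_polyDl size_polyXn //.
  by rewrite (leq_ltn_trans (size_polyD _ _)) // size_polyX size_polyC; case: eqP.
- have -> : 'X^#|F| - 'X = 'X^(2 ^ (m + m)) + 'X + (abs_tr (m + m) c)%:P.
    have -> : abs_tr (m + m) c = 0.
      rewrite /abs_tr big_split_ord /=.
      rewrite [X in _ + X](eq_bigr (fun i : 'I_m => c ^+ (2 ^ i))).
        by rewrite addrr_pchar2.
      by move=> i _; rewrite expnD exprM -hq cq.
    by rewrite addr0 oppr_pchar2 ?pchar_poly // expnD -hq hF mulnn.
  exact: dvdp_artin_schreier.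
rewrite /root !hornerE => /eqP zc; exists z.
exact: addr_eq0_pchar2.
Qed.

(** * Roots in F_q of a depressed cubic, through its quadratic resolvent *)

Section Cubic.

Variables al be : F.
Hypotheses (al_q : al ^+ q = al) (be_q : be ^+ q = be).
Hypotheses (al0 : al != 0) (be0 : be != 0).

Let cubic y := y ^+ 3 + al * y + be.
Let resolvent t := t ^+ 2 + be * t + al ^+ 3.

(** In characteristic 2, (u + v)^3 = u^3 + v^3 + uv(u + v), so only [be = u ^+ 3 + v ^+ 3] is
    needed; this is the resolvent equation divided by u^3. *)
Lemma cardano_root (u v : F) :
  u * v = al -> u != 0 -> resolvent (u ^+ 3) = 0 -> cubic (u + v) = 0.
Proof.
rewrite /resolvent /cubic => <- u0 r0.
suff -> : be = u ^+ 3 + v ^+ 3 by ring2 F2.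
apply: (mulfI (expf_neq0 3 u0)); apply: addr_eq0_pchar2 => //.
by rewrite -r0; ring2 F2.
Qed.

(** With [t = be * z] the resolvent becomes z^2 + z = al^3 / be^2, and the trace of the right-hand
    side is z^q + z, which is 0 or 1. In the second case [t] and its conjugate are the two roots,
    with product al^3. *)
Lemma resolvent_frob (t : F) : resolvent t = 0 ->
  (t ^+ q = t /\ abs_tr m (al ^+ 3 / be ^+ 2) = 0)
  \/ (t * t ^+ q = al ^+ 3 /\ abs_tr m (al ^+ 3 / be ^+ 2) = 1).
Proof.
rewrite /resolvent => r0.
have [z tE zE] : exists2 z, t = be * z & z ^+ 2 + z = al ^+ 3 / be ^+ 2.
  exists (t / be); first by rewrite mulrC divfK.
  have -> : al ^+ 3 = t ^+ 2 + be * t.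
    by apply: addr_eq0_pchar2; rewrite // -r0; ring2 F2.
  by field.
have trE := abs_tr_artin_schreier m z F2; rewrite zE -hq in trE.
have zqE : z ^+ q ^+ 2 + z ^+ q = al ^+ 3 / be ^+ 2.
  by rewrite -exprAC -frobD zE frob_div !(exprAC _ _ q) al_q be_q.
have /eqP : (z ^+ q + z) * (z ^+ q + z + 1) = 0.
  have -> : (z ^+ q + z) * (z ^+ q + z + 1)
      = (z ^+ q ^+ 2 + z ^+ q) + (z ^+ 2 + z) by ring2 F2.
  by rewrite zE zqE addrr_pchar2.
rewrite mulf_eq0 !addr_eq0 !oppr_pchar2 // trE tE exprMn be_q => /orP[]/eqP zq.
  by left; rewrite zq addrr_pchar2.
right; split=> //; have -> : z ^+ q = z + 1 by rewrite -zq; ring2 F2.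
suff -> : al ^+ 3 = be ^+ 2 * (z ^+ 2 + z) by ring.
by rewrite zE; field.
Qed.

Lemma resolvent_exists : exists t, resolvent t = 0.
Proof.
have [|z zE] := @artin_schreier_root (al ^+ 3 / be ^+ 2).
  by rewrite frob_div !(exprAC _ _ q) al_q be_q.
exists (be * z); rewrite /resolvent.
have -> : al ^+ 3 = be ^+ 2 * (z ^+ 2 + z) by rewrite zE; field.
by ring2 F2.
Qed.

(** Here Cardano's second summand is the conjugate of [u], so the root is fixed by Frobenius. *)
Lemma cube_norm_root (u : F) :
  resolvent (u ^+ 3) = 0 -> u * u ^+ q = al ->
  exists2 y, y ^+ q = y & cubic y = 0.
Proof.
move=> r0 uu; exists (u + u ^+ q); first by rewrite frobD frobK addrC.
apply: cardano_root => //; apply: contraNneq al0 => u0.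
by rewrite -uu u0 mul0r.
Qed.

Lemma resolvent_neq0 (t : F) : resolvent t = 0 -> t != 0.
Proof.
move=> r0; apply: contraNneq al0 => t0; move: r0; rewrite /resolvent t0.
by rewrite expr0n mulr0 !add0r => /eqP; rewrite expf_eq0.
Qed.

Lemma cube_subfield_root (u : F) :
  resolvent (u ^+ 3) = 0 -> u ^+ q = u -> exists2 y, y ^+ q = y & cubic y = 0.
Proof.
move=> r0 uq; have /[!expf_eq0]/= u0 := resolvent_neq0 r0.
exists (u + al / u); first by rewrite frobD frob_div al_q uq.
by apply: cardano_root => //; rewrite mulrC divfK.
Qed.

Lemma cube_root_subfield_odd (t : F) :
  odd m -> t ^+ q = t -> exists2 u, u ^+ q = u & t = u ^+ 3.
Proof.
move=> m_odd tq; have [j jE] := pow2_mod3 m; rewrite m_odd -hq in jE.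
have [->|t0] := eqVneq t 0.
  by exists 0; rewrite expr0n // hq expn_eq0.
(* As q = 3j + 2, 3(2j + 1) = 2(q - 1) + 1: the exponent inverts 3 modulo q - 1. *)
exists (t ^+ (2 * j + 1)); first by rewrite -exprM mulnC exprM tq.
apply: (mulfI t0); rewrite -exprM -exprS -expr2 -{1}tq -exprM.
by congr (t ^+ _); lia.
Qed.

Lemma subfield_cube1_odd (w : F) : odd m -> w ^+ q = w -> w ^+ 3 = 1 -> w = 1.
Proof.
move=> m_odd wq w3; have [j jE] := pow2_mod3 m; rewrite m_odd -hq in jE.
have w0 : w != 0.
  by apply: contra_eq_neq w3 => ->; rewrite expr0n eq_sym oner_neq0.
by apply: (mulfI w0); rewrite mulr1 -[RHS]wq jE exprD exprM w3 expr1n mul1r.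
Qed.

Lemma resolvent_norm_cube_even (t : F) :
  ~~ odd m -> t * t ^+ q = al ^+ 3 -> exists u, t = u ^+ 3.
Proof.
move=> /negPf m_even tt; have [j jE] := pow2_mod3 m; rewrite m_even -hq in jE.
(* As q = 3j + 1, 3(q + 1)j = q^2 - 1, and raising [t] to the power (q + 1)j gives al^(3j) = al^(q -
   1) = 1. *)
apply: (@finField_expf_surj _ 3 ((q + 1) * j)%N).
  by rewrite hF; lia.
rewrite exprM addn1 exprS tt -exprM; apply: (mulfI al0).
by rewrite mulr1 -exprS -[RHS]al_q jE addn1.
Qed.

Lemma cubic_root_even (u : F) :
  ~~ odd m -> resolvent (u ^+ 3) = 0 -> u ^+ 3 * u ^+ 3 ^+ q = al ^+ 3 ->
  exists2 y, y ^+ q = y & cubic y = 0.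
Proof.
move=> m_even r0 uu3.
have [w wE [w3 wq]] : exists2 w, u * u ^+ q = w * al & w ^+ 3 = 1 /\ w ^+ q = w.
  exists (u * u ^+ q / al); first by rewrite divfK.
  split; last by rewrite frob_div exprMn frobK al_q [u * _]mulrC.
  by rewrite expr_div_n exprMn (exprAC _ q) uu3 divff // expf_neq0.
(* [w] has norm [w ^+ 2], so scaling [u] by it turns the norm into [al]. *)
apply: (@cube_norm_root (w * u)); first by rewrite exprMn w3 mul1r.
rewrite exprMn wq mulrACA wE mulrA -[RHS]mul1r -w3; congr (_ * _); ring.
Qed.

(** If [u ^+ 3] lies in F_q, it also has a cube root in F_q. Otherwise the norm of [u] is [al] times
    a cube root of unity of F_q, and for odd [m] that is 1. *)
Lemma cubic_root_odd (u : F) :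
  odd m -> resolvent (u ^+ 3) = 0 -> exists2 y, y ^+ q = y & cubic y = 0.
Proof.
move=> m_odd r0; have [[tq _]|[uu3 _]] := resolvent_frob r0.
  have [v vq tv] := cube_root_subfield_odd m_odd tq.
  by apply: (@cube_subfield_root v); rewrite -?tv.
apply: (@cube_norm_root u) => //.
have -> : u * u ^+ q = (u * u ^+ q / al) * al by rewrite divfK.
rewrite (@subfield_cube1_odd (u * u ^+ q / al)) ?mul1r //.
  by rewrite frob_div exprMn frobK al_q [u * _]mulrC.
by rewrite expr_div_n exprMn (exprAC _ q) uu3 divff // expf_neq0.
Qed.

(** Inverts Cardano: [u] and [u + y] are to have product [al], and [u = y * z] reduces this to an
    Artin-Schreier equation, solvable in [F]. *)
Lemma cubic_root_cardano (y : F) : y ^+ q = y -> cubic y = 0 ->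
  exists u, resolvent (u ^+ 3) = 0 /\ (u ^+ 3 ^+ q = u ^+ 3 -> u ^+ q = u).
Proof.
move=> yq; rewrite /cubic /resolvent => r0.
have y0 : y != 0.
  apply: contraNneq be0 => y0; move: r0; rewrite y0.
  by rewrite expr0n mulr0 !add0r => ->.
have [|z zE] := @artin_schreier_root (al / y ^+ 2).
  by rewrite frob_div al_q exprAC yq.
have alE : al = (y * z) * (y * z + y).
  rewrite -[LHS](divfK (expf_neq0 2 y0)) -zE; ring.
have beE : be = (y * z) ^+ 3 + (y * z + y) ^+ 3.
  by apply: addr_eq0_pchar2; rewrite // -r0 alE; ring2 F2.
exists (y * z); move: alE beE; set u := y * z => alE beE.
split; first by rewrite alE beE; ring2 F2.
move=> u3q.
(* Frobenius permutes the roots [u], [u + y] of X^2 + yX + al; a swap would give u^3 = (u + y)^3,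
   hence [be = 0]. *)
have /eqP : (u ^+ q + u) * (u ^+ q + (u + y)) = 0.
  have -> : (u ^+ q + u) * (u ^+ q + (u + y))
      = u ^+ q * (u ^+ q + y) + u * (u + y).
    by ring2 F2.
  by rewrite -alE -{1}yq -frobD -exprMn -alE al_q addrr_pchar2.
rewrite mulf_eq0 !addr_eq0 !oppr_pchar2 // => /orP[/eqP //|/eqP uq].
by case/eqP: be0; rewrite beE -uq -exprAC u3q addrr_pchar2.
Qed.

Lemma cubic_no_root_iff :
  (forall y, y ^+ q = y -> cubic y != 0) <->
  abs_tr m (al ^+ 3 / be ^+ 2) = abs_tr m 1 /\
  (forall t, resolvent t = 0 ->
     (~~ odd m -> forall u, u ^+ q = u -> t <> u ^+ 3) /\
     (odd m -> forall u, t <> u ^+ 3)).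
Proof.
rewrite (abs_tr1 m F2); split=> [noroot|[tr_eq nocube] y yq].
  have noroot' : ~ exists2 y, y ^+ q = y & cubic y = 0.
    by case=> y yq /eqP; apply/negP/noroot.
  split; last first.
    move=> t r0; split=> [m_even u uq|m_odd u] tE; apply: noroot'; subst t.
      exact: cube_subfield_root uq.
    exact: cubic_root_odd r0.
  (* A trace different from that of 1 always makes [t] a cube: for odd [m] it lies in F_q, for even
     [m] it has norm al^3. Either way the cubic gets a root. *)
  have [t r0] := resolvent_exists.
  have [[tq ->]|[tt ->]] := resolvent_frob r0;
    case: (boolP (odd m)) => [m_odd|m_even] //.
    have [u uq tE] := cube_root_subfield_odd m_odd tq.
    by case: noroot'; apply: cube_subfield_root uq; rewrite -tE.
  have [u tE] := resolvent_norm_cube_even m_even tt.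
  by case: noroot'; apply: (@cubic_root_even u); rewrite -?tE.
apply/eqP => y_root; have [u [r0 u_sub]] := cubic_root_cardano yq y_root.
have [nc_even nc_odd] := nocube _ r0.
have [m_odd|m_even] := boolP (odd m); first exact: (nc_odd m_odd u).
apply: (nc_even m_even u) => //; apply: u_sub.
move: tr_eq; rewrite (negPf m_even).
by case: (resolvent_frob r0) => [[]//|[_ ->] /eqP]; rewrite oner_eq0.
Qed.

End Cubic.

(** * Moebius transfer between the roots of unity and F_q *)

Lemma cubic_mu_root_iff (a b : F) : b ^+ q = b -> a ^+ q != a ->
  (forall x, x ^+ (q + 1) = 1 ->
     a ^+ q + b * x + b * x ^+ 2 + a * x ^+ 3 != 0) <->
  (forall y, y ^+ q = y ->
     y ^+ 3 + (a ^+ q + b) * (a + b) * y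
       + (a + a ^+ q) * (a ^+ (q + 1) + b ^+ 2) != 0).
Proof.
move=> bq aq; rewrite addn1 exprS.
have T0 : a + a ^+ q != 0.
  by apply: contraNneq aq => /(addr_eq0_pchar2 F2) {1}<-.
(* The Moebius substitution with denominators cleared. *)
have key x y : x * (y + (a + b)) = y + (a ^+ q + b) ->
    (a ^+ q + b * x + b * x ^+ 2 + a * x ^+ 3) * (y + (a + b)) ^+ 3
    = (a + a ^+ q) * (y ^+ 3 + (a ^+ q + b) * (a + b) * y
                      + (a + a ^+ q) * (a * a ^+ q + b ^+ 2)).
  move=> xy.
  have -> : (a ^+ q + b * x + b * x ^+ 2 + a * x ^+ 3) * (y + (a + b)) ^+ 3
    = a ^+ q * (y + (a + b)) ^+ 3
      + b * (x * (y + (a + b))) * (y + (a + b)) ^+ 2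
      + b * (x * (y + (a + b))) ^+ 2 * (y + (a + b))
      + a * (x * (y + (a + b))) ^+ 3 by ring.
  by rewrite xy; ring2 F2.
have frob_ab : (a + b) ^+ q = a ^+ q + b by rewrite frobD bq.
split=> noroot.
- move=> y yq; have y_ab : y + (a + b) != 0.
    apply: contraNneq aq => /(addr_eq0_pchar2 F2) yE; move: yq.
    by rewrite yE frob_ab => /addIr ->.
  have y_ab' : y + (a ^+ q + b) != 0 by rewrite -frob_ab -yq -frobD expf_neq0.
  pose x := (y + (a ^+ q + b)) / (y + (a + b)).
  have xE : x * (y + (a + b)) = y + (a ^+ q + b) by rewrite divfK.
  (* Frobenius exchanges the numerator and the denominator of [x]. *)
  have /noroot x_root : x ^+ q.+1 = 1.
    rewrite exprSr /x frob_div !frobD frobK bq yq.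
    by field; rewrite y_ab y_ab'.
  apply: contraNneq x_root => r0; apply/eqP.
  by apply: (mulIf (expf_neq0 3 y_ab)); rewrite mul0r (key _ _ xE) r0 mulr0.
move=> x x_mu; apply/eqP => x_root.
(* 1 is the image of infinity; there the form takes the value [a + a ^+ q]. *)
have x1 : x + 1 != 0.
  apply: contraNneq T0 => /(addr_eq0_pchar2 F2) x1.
  by rewrite -x_root x1; apply/eqP; ring2 F2.
have [y yE] : exists y, y * (x + 1) = x * (a + b) + (a ^+ q + b).
  by exists ((x * (a + b) + (a ^+ q + b)) / (x + 1)); rewrite divfK.
have yq : y ^+ q = y.
  apply: (mulIf x1); rewrite [RHS]yE.
  have := congr1 (fun u => x * u ^+ q) yE.
  rewrite !(exprMn, frobD) frobK bq expr1n => yqE.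
  have -> : y ^+ q * (x + 1) = x * (y ^+ q * (x ^+ q + 1)).
    by rewrite mulrCA [x * _]mulrDr mulr1 -exprS x_mu addrC.
  by rewrite yqE mulrDr mulrA -exprS x_mu mul1r addrC.
have xyE : x * (y + (a + b)) = y + (a ^+ q + b).
  apply: addr_eq0_pchar2 => //.
  have -> : x * (y + (a + b)) + (y + (a ^+ q + b))
    = y * (x + 1) + (x * (a + b) + (a ^+ q + b)) by ring.
  by rewrite yE addrr_pchar2.
have /negP[] := noroot y yq; rewrite -(mulrI_eq0 _ (mulfI T0)) -(key _ _ xyE).
by rewrite x_root mul0r.
Qed.

(** * Frobenius on values, the subfield F_q, and the permutation criterion *)

Lemma frob_horner (B : {poly F}) (x : F) :
  B.[x] ^+ q = (conj_poly q B).[x ^+ q].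
Proof.
have q0 : (0 : F) ^+ q = 0 by rewrite hq expr0n expn_eq0.
rewrite horner_coef (@horner_coef_wide _ (size B) (conj_poly q B)) ?size_poly //.
rewrite (big_morph (fun y => y ^+ q) frobD q0); apply: eq_bigr => i _.
by rewrite exprMn exprAC /conj_poly coef_map_id0.
Qed.

(** Multiplication by a nonzero [y] of [Fq] permutes the nonzero elements, so their product shows
    y^(q - 1) = 1; equality follows since X^q - X has at most q roots. *)
Lemma subfield_frobE (Fq : {set F}) (x : F) :
  GRing.divring_closed (mem Fq) -> #|Fq| = q -> (x \in Fq) = (x ^+ q == x).
Proof.
move=> [Fq1 FqB FqV] cardFq.
have Fq0 : 0 \in Fq by have := FqB _ _ Fq1 Fq1; rewrite subrr.
have FqM y z : y \in Fq -> z \in Fq -> y * z \in Fq.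
  by move=> Fy Fz; have := FqV _ _ Fy (FqV _ _ Fq1 Fz); rewrite div1r invrK.
have q_gt1 : (1 < q)%N.
  by rewrite -cardFq (cardD1 0) (cardD1 1) !inE oner_eq0 Fq0 Fq1.
suff -> : Fq = [set y | y ^+ q == y] by rewrite inE.
apply/eqP; rewrite eqEcard; apply/andP; split.
  apply/subsetP => y Fy; rewrite inE; have [->|y0] := eqVneq y 0.
    by rewrite expr0n eqn0Ngt ltnW.
  pose P := \prod_(z in Fq :\ 0) z.
  have P0 : P != 0 by apply/prodf_neq0 => z; rewrite !inE => /andP[].
  have : P = y ^+ q.-1 * P.
    rewrite {1}/P (reindex_inj (mulfI y0)) /=.
    rewrite (eq_bigl (mem (Fq :\ 0))) => [|z].
      by rewrite big_split prodr_const -cardFq (cardsD1 0 Fq) Fq0.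
    rewrite !inE mulf_eq0 (negPf y0) /=; congr (_ && _).
    apply/idP/idP; last exact: FqM.
    by move=> Fyz; have := FqV _ _ Fyz Fy; rewrite mulrC mulKf.
  rewrite -{1}[P]mul1r => /(mulIf P0) y1.
  by rewrite -(prednK (ltnW q_gt1)) exprS -y1 mulr1.
rewrite cardFq cardE.
have sizeE : size ('X^q - 'X : {poly F}) = q.+1.
  by rewrite size_polyDl ?size_polyXn // size_polyN size_polyX.
rewrite -ltnS -sizeE; apply: max_poly_roots; last exact: enum_uniq.
  by rewrite -size_poly_eq0 sizeE.
by apply/allP => y; rewrite mem_enum inE /root !hornerE subr_eq0.
Qed.

(** The map x -> x^(q - 1) carries [f] to the given injective map on the roots of unity, so it
    remains to separate points in each fibre, where [f] is a nonzero constant times x^s. *)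
Lemma permutes_mu_iff (r s : nat) (B : {poly F}) (h : F -> F) :
  (0 < s)%N -> s = r + 3 %[mod q + 1] ->
  {in mu F (q + 1), forall x, ~~ root B x} ->
  {in mu F (q + 1) &,
     injective (fun x => x ^+ r * (conj_poly q B).[1 / x] / B.[x])} ->
  (forall x, x ^+ (q + 1) = 1 -> x ^+ 3 * h x ^+ q = h x) ->
  permutes [set: F]
    (fun x => x ^+ s * B.[x ^+ (q - 1)] * h (x ^+ (q - 1))) <->
  gcdn s (q - 1) = 1%N /\ (forall x, x ^+ (q + 1) = 1 -> h x != 0).
Proof.
move=> s_gt0 s_mod B0 g_inj h_conj.
have q_gt0 : (0 < q)%N by rewrite hq expn_gt0.
have qE : (q - 1).+1 = q by rewrite subn1 prednK.
have cardF1 : ((q - 1) * (q + 1) = #|F|.-1)%N.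
  by rewrite -subn_sqr exp1n subn1 hF.
have mu_pow (x : F) : x != 0 -> x ^+ (q - 1) ^+ (q + 1) = 1.
  by move=> x0; rewrite -exprM cardF1 expf_card_pred.
have in_mu (x : F) : x ^+ (q + 1) = 1 -> x \in mu F (q + 1).
  by move=> xq; rewrite inE unity_rootE xq.
set f := fun x => _; split=> [[_ f_inj]|[gcd1 h0]].
  split.
    have [g gP] := finField_primitive_root F.
    set d := gcdn s (q - 1).
    have [d_s d_q] : (d %| s /\ d %| q - 1)%N by rewrite dvdn_gcdl dvdn_gcdr.
    have d_card : (d %| #|F|.-1)%N by rewrite -cardF1 dvdn_mulr.
    (* An element of order [d]; as [d] divides both [s] and [q - 1], [f] takes the same value at [c]
       and at 1. *)
    pose c := g ^+ (#|F|.-1 %/ d).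
    have c_pow n : (d %| n)%N -> c ^+ n = 1.
      case/dvdnP=> k ->; rewrite /c -exprM mulnCA divnK // mulnC exprM.
      by rewrite (prim_expr_order gP) expr1n.
    have : c = 1.
      by apply: f_inj; rewrite ?inE // /f !c_pow // !expr1n.
    move/eqP; rewrite /c -(prim_order_dvd gP) => dvd_d.
    exact: dvdn_div_eq1 (prim_order_gt0 gP) d_card dvd_d.
  move=> z z_mu; apply/eqP => hz0.
  (* A root z = x^(q - 1) of [h] would give [f x = f 0] with [x] nonzero. *)
  have [x zE] := finField_expf_surj cardF1 z_mu.
  have x0 : x = 0.
    apply: f_inj; rewrite ?inE // /f -zE hz0 mulr0 expr0n.
    by rewrite eqn0Ngt s_gt0 !mul0r.
  have q1_gt0 : (0 < q - 1)%N.
    by have := finNzRing_gt1 F; rewrite -ltn_predRL -cardF1; case: (q - 1)%N.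
  move: z_mu; rewrite zE x0 expr0n eqn0Ngt q1_gt0 expr0n addn1.
  by move/esym/eqP; rewrite oner_eq0.
have f_neq0 x : x != 0 -> f x != 0.
  move=> x0; rewrite !mulf_neq0 ?expf_neq0 ?h0 ?mu_pow //.
  by have := B0 _ (in_mu _ (mu_pow _ x0)); rewrite rootE.
have f0 : f 0 = 0 by rewrite /f expr0n eqn0Ngt s_gt0 !mul0r.
have f_frob x : x != 0 -> f x ^+ (q - 1)
    = (fun z => z ^+ r * (conj_poly q B).[1 / z] / B.[z]) (x ^+ (q - 1)).
  move=> x0; apply: (mulIf (f_neq0 x x0)); rewrite -exprSr qE.
  rewrite /f !exprMn frob_horner [x ^+ s ^+ q]exprAC.
  have -> : x ^+ q = x * x ^+ (q - 1) by rewrite -exprS qE.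
  have z_mu := mu_pow x x0; have := B0 _ (in_mu _ z_mu).
  move: (x ^+ (q - 1)) z_mu => z z_mu; rewrite rootE => Bz0.
  have z0 : z != 0.
    by apply: contra_eq_neq z_mu => ->; rewrite addn1 expr0n eq_sym oner_eq0.
  have -> : z ^+ q = 1 / z.
    by apply: (mulIf z0); rewrite -exprSr -addn1 z_mu divfK.
  (* The congruence on [s] is used here; the factor z^3 is then absorbed by [h_conj]. *)
  have -> : (x * z) ^+ s = x ^+ s * (z ^+ r * z ^+ 3).
    rewrite exprMn -exprD; congr (_ * _).
    by rewrite -(expr_mod s z_mu) s_mod expr_mod.
  by rewrite -{2}(h_conj z z_mu); field; rewrite Bz0.
have f_inj : injective f.
  move=> x y; have [->|x0] := eqVneq x 0; have [->|y0] := eqVneq y 0 => //.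
  - by rewrite f0 => /esym/eqP; rewrite (negPf (f_neq0 _ y0)).
  - by rewrite f0 => /eqP; rewrite (negPf (f_neq0 _ x0)).
  move=> fxy; have zxy : x ^+ (q - 1) = y ^+ (q - 1).
    by apply: g_inj; rewrite ?in_mu ?mu_pow // -!f_frob // fxy.
  have sxy : x ^+ s = y ^+ s.
    move: fxy; rewrite /f zxy -!mulrA => /mulIf; apply.
    have := f_neq0 y y0; rewrite /f -mulrA mulf_eq0 negb_or.
    by case/andP.
  (* Bezout: us = v(q - 1) + 1, so x^s and x^(q - 1) determine [x]. *)
  have [u v uv _] := egcdnP (q - 1) s_gt0.
  have : x ^+ (u * s) = y ^+ (u * s) by rewrite mulnC !exprM sxy.
  rewrite uv gcd1 !addn1 !exprS mulnC !exprM zxy => /mulIf; apply.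
  by rewrite !expf_neq0.
split; last by move=> x y _ _; apply: f_inj.
by apply/eqP; rewrite eqEcard subsetT card_imset //= leqnn.
Qed.

End QuadraticExtension.

(** * Assembling the equivalence *)

Lemma eq_permutes (F : finFieldType) (A : {set F}) (f g : F -> F) :
  f =1 g -> permutes A f <-> permutes A g.
Proof.
move=> fg; rewrite /permutes (eq_imset _ fg).
split=> -[-> f_inj]; split=> // x y Ax Ay.
  by rewrite -!fg; apply: f_inj.
by rewrite !fg; apply: f_inj.
Qed.

Theorem theorem3p11 (m q : nat) (hm : (1 <= m)%N) (hq : q = (2 ^ m)%N)
  (F : finFieldType) (hF : #|F| = (q ^ 2)%N)
  (Fq : {set F}) (hFq : GRing.divring_closed (mem Fq)) (cardFq : #|Fq| = q)
  (r s : nat) (hr : (0 < r)%N) (hs : (0 < s)%N)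
  (hrs : s = r + 3 %[mod q + 1])
  (B : {poly F})
  (hB : {in mu F (q + 1), forall x, ~~ root B x})
  (hperm : permutes (mu F (q + 1))
             (fun x => x ^+ r * (conj_poly q B).[1 / x] / B.[x]))
  (a b : F) (ha : a \notin Fq) (hb : b \in Fq) (hb0 : b != 0)
  (hab : a ^+ (q + 1) + b ^+ 2 != 0) :
  permutes [set: F] (fun x => (perm_poly3 q s B a b).[x])
  <->
  [/\ gcdn s (q - 1) = 1%N,
      abs_tr m ((a ^+ q + b) ^+ 3 * (a + b) ^+ 3
                / ((a + a ^+ q) ^+ 2 * (a ^+ (q + 1) + b ^+ 2) ^+ 2))
        = abs_tr m 1
    & forall d : F, d \notin Fq ->
      forall t : F, root (cube_quadratic q a b d) t ->
        (~~ odd m -> ~ cube_in Fq t) /\ (odd m -> ~ cube_in [set: F] t)].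

Proof.
have F2 := pchar2_of_card hq hF.
have FqE x := subfield_frobE x hFq cardFq.
have bq : b ^+ q = b by apply/eqP; rewrite -FqE.
have aq : a ^+ q != a by rewrite -FqE.
have frobD := frobD hq hF; have frobK := frobK hF.
have T0 : a + a ^+ q != 0.
  by apply: contraNneq aq => /(addr_eq0_pchar2 F2) {1}<-.
pose h x := a ^+ q + b * x + b * x ^+ 2 + a * x ^+ 3.
have h_conj x : x ^+ (q + 1) = 1 -> x ^+ 3 * h x ^+ q = h x.
  rewrite addn1 exprS /h !frobD !exprMn frobK bq => xq.
  transitivity (a ^+ q * (x * x ^+ q) ^+ 3 + b * (x * x ^+ q) ^+ 2 * x
                + b * (x * x ^+ q) * x ^+ 2 + a * x ^+ 3); first by ring.
  by rewrite xq !expr1n !mulr1.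
have B_inj := hperm.2.
apply: (iff_trans (eq_permutes _ (_ : _ =1 fun x =>
  x ^+ s * B.[x ^+ (q - 1)] * h (x ^+ (q - 1))))).
  move=> x; rewrite /perm_poly3 !hornerE horner_comp !hornerE.
  by rewrite /h ![(_ * (q - 1))%N]mulnC !exprM.
apply: (iff_trans (permutes_mu_iff hq hF hs hrs hB B_inj h_conj)).
pose al := (a ^+ q + b) * (a + b).
pose be := (a + a ^+ q) * (a ^+ (q + 1) + b ^+ 2).
have abq : (a + b) ^+ q = a ^+ q + b by rewrite frobD bq.
have ab0 : a + b != 0.
  by apply: contraNneq aq => /(addr_eq0_pchar2 F2) ->; rewrite bq.
have al_q : al ^+ q = al by rewrite /al exprMn -abq frobK mulrC.
have be_q : be ^+ q = be.
  rewrite /be addn1 exprS expr2 !(exprMn, frobD) frobK bq.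
  by rewrite [a ^+ q + a]addrC [a ^+ q * a]mulrC.
have al0 : al != 0 by rewrite /al -abq mulf_neq0 // expf_neq0.
have be0 : be != 0 by rewrite /be mulf_neq0.
(* The scaling factor (d + d^q) / (a + a^q) lies in F_q, so dividing [t] by its cube preserves being
   a cube in either field. *)
have scale d t : d + d ^+ q != 0 -> root (cube_quadratic q a b d) t =
    ((t / ((d + d ^+ q) / (a + a ^+ q)) ^+ 3) ^+ 2
     + be * (t / ((d + d ^+ q) / (a + a ^+ q)) ^+ 3) + al ^+ 3 == 0).
  move=> D0; rewrite /root /cube_quadratic [d ^+ q + d]addrC.
  rewrite !(hornerD, hornerZ, hornerXn, hornerX, hornerC).
  rewrite -[RHS](mulrI_eq0 _ (mulfI (expf_neq0 6 (mulf_neq0 D0 (invr_neq0 T0))))).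
  congr (_ == _); rewrite /al /be; field; by rewrite D0 T0.
have := cubic_no_root_iff hq hF al_q be_q al0 be0.
rewrite {1}/al {1}/be => cubicP.
have muP := cubic_mu_root_iff hq hF bq aq.
have trE : al ^+ 3 / be ^+ 2 = (a ^+ q + b) ^+ 3 * (a + b) ^+ 3
                / ((a + a ^+ q) ^+ 2 * (a ^+ (q + 1) + b ^+ 2) ^+ 2).
  by rewrite /al /be !exprMn.
rewrite trE in cubicP.
split=> [[gcd1 /muP/cubicP[tr_eq nocube]]|[gcd1 tr_eq nocube]]; split=> //.
  move=> d Fd t; have D0 : d + d ^+ q != 0.
    by apply: contraNneq Fd => /(addr_eq0_pchar2 F2) dq; rewrite FqE -dq.
  rewrite scale // => /eqP /nocube[nc_even nc_odd].
  split=> [m_even|m_odd] [u Fu tE].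
    apply: (nc_even m_even (u / ((d + d ^+ q) / (a + a ^+ q)))).
      move: Fu; rewrite FqE => /eqP uq.
      by rewrite !frob_div !frobD !frobK uq [d ^+ q + d]addrC [a ^+ q + a]addrC.
    by rewrite tE [RHS]expr_div_n.
  apply: (nc_odd m_odd (u / ((d + d ^+ q) / (a + a ^+ q)))).
  by rewrite tE [RHS]expr_div_n.
apply/muP/cubicP; split=> // t r0.
(* For [d = a] the scaling factor is 1. *)
have [|nc_even nc_odd] := nocube a ha t.
  by rewrite scale // divff // expr1n divr1 r0.
split=> [m_even u uq tE|m_odd u tE].
  by apply: (nc_even m_even); exists u; rewrite // FqE uq.
by apply: (nc_odd m_odd); exists u.
Qed.
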